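(* Let $\alpha\in(0,1)$ and suppose there is no changepoint ($T=\infty$), so that $X_1,X_2,\ldots$ is a trajectory of some $P_0\in\mathcal{P}$ with $\theta(P_0)=\theta_0$ (and, in the partitioned problem, $\theta_0\in\Theta_0$). Let $\tau$ be the stopping time of the repeated-FCS-Detector, i.e. a new level-$(1-\alpha)$ forward confidence sequence $(C^{(m)}_n)_{n\ge m}$ for $\theta$ is started at each time $m\ge 1$ using the data $X_m,X_{m+1},\ldots$, one sets $C^{(0)}_n=\Theta$ for all $n$ (non-partitioned problem) or $C^{(0)}_n=\Theta_0$ for all $n$ (partitioned problem), and $\tau$ is the first time at which the intersection of all initialized confidence sequences is empty. Then, in both the non-partitioned and the partitioned problem, $$\mathbb{E}_\infty[\tau]\ \ge\ \frac{1}{\alpha}.$$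
   Context: Setting. $\mathcal{X}$ is a general observation space, $\mathcal{P}$ is a class of probability distributions on $\Omega=\mathcal{X}^\infty$ (not necessarily i.i.d. or product laws), and $\theta:\mathcal{P}\to\Theta$ is a functional with values in a (possibly infinite dimensional) parameter space $\Theta$. The data stream is $X_1,X_2,\ldots$, with natural filtration $\mathcal{F}_n=\sigma(X_1,\ldots,X_n)$, $\mathcal{F}_0=\{\emptyset,\Omega\}$. For an unknown $T\in\mathbb{N}\cup\{\infty\}$, the observations $(X_n)_{n\le T}$ are drawn from $P_0\in\mathcal{P}$ with $\theta(P_0)=\theta_0$, and $(X_n)_{n>T}$ are drawn from $P_1\in\mathcal{P}$ with $\theta(P_1)=\theta_1\ne\theta_0$. The case $T=\infty$ means no change occurs; probability and expectation are then written $\mathbb{P}_\infty$, $\mathbb{E}_\infty$. Non-partitioned problem: nothing is known about $\theta_0,\theta_1$. Partitioned problem: a set $\Theta_0\subset\Theta$ is known, with $\theta_0\in\Theta_0$ and $\theta_1\notin\Theta_0$. Confidence sequence (CS). Given observations drawn from a distribution $P$, a level-$(1-\alpha)$ CS for $\theta(P)$ is a sequence of sets $C_n\subset\Theta$ such that $C_n$ is measurable with respect to the first $n$ observations and $\mathbb{P}(\forall n\in\mathbb{N}:\theta(P)\in C_n)\ge 1-\alpha$. repeated-FCS-Detector. For every $m\ge1$, $C^{(m)}=(C^{(m)}_n)_{n\ge m}$ is a level-$(1-\alpha)$ CS formed from the data $X_m,X_{m+1},\ldots$: $C^{(m)}_n$ is constructed from $X_m,\ldots,X_n$, and, when $T=\infty$,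 it satisfies the level-$(1-\alpha)$ uniform coverage guarantee for $\theta_0$, $\mathbb{P}_\infty(\forall n\ge m:\theta_0\in C^{(m)}_n)\ge 1-\alpha$. Set $C^{(0)}_n=\Theta$ for all $n$ (non-partitioned) or $C^{(0)}_n=\Theta_0$ for all $n$ (partitioned). The CSs are taken nested without loss of generality ($C^{(m)}_n\subset C^{(m)}_{n'}$ for $m\le n'<n$), and $$\tau=\inf\Big\{n\ge1:\ \bigcap_{m=0}^n C^{(m)}_n=\emptyset\Big\};$$ if they are not nested, the criterion is $\bigcap_{m=0}^n\bigcap_{i=m}^n C^{(m)}_i=\emptyset$. By convention $\inf\emptyset=\infty$.
   Formalization: The coverage guarantee of the confidence sequence started at time m is required conditionally on X_1,…,X_{m-1} (automatic for independent data); with only unconditional coverage the claim fails for dependent observations. *)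

(* Defs.v *)
From HB Require Import structures.
From mathcomp Require Import all_boot all_order all_algebra.
From mathcomp Require Import all_classical all_reals all_analysis.

Set Implicit Arguments.
Unset Strict Implicit.
Unset Printing Implicit Defensive.

Import Order.TTheory GRing.Theory Num.Theory.
Local Open Scope classical_set_scope.
Local Open Scope ring_scope.

(* Observations are numbered from 1: [obs k] is X_k for [1 <= k], and [obs 0]
   is never used. *)
Definition obs (X : Type) (k : nat) (w : nat -> X) : X := w k.-1.

Definition cylinders (d : measure_display) (X : measurableType d)
    (I : set nat) : set (set (nat -> X)) :=
  [set B | exists k A, [/\ I k, measurable A & B = @obs X k @^-1` A]].
Arguments cylinders {d} X I.

(* sigma (X_k, k in I) *)
Definition obs_sigma (d : measure_display) (X : measurableType d)
    (I : set nat) : set (set (nat -> X)) := <<s cylinders X I >>.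
Arguments obs_sigma {d} X I.

(* X^oo with the product sigma-algebra *)
Definition stream (d : measure_display) (X : measurableType d) :=
  g_sigma_algebraType (cylinders X [set k | (1 <= k)%N]).

Definition natural_filtration (d : measure_display) (X : measurableType d)
    (n : nat) : set (set (nat -> X)) :=
  obs_sigma X [set k | (1 <= k <= n)%N].
Arguments natural_filtration {d} X n.

Section confidence_sequences.
Context (R : realType) (d : measure_display) (X : measurableType d).
Context (Theta : Type).
Local Open Scope ereal_scope.

Implicit Types (P : probability (stream X) R) (th : Theta) (alpha : R).
Implicit Types (m : nat) (C : nat -> stream X -> set Theta).

(* [C n w] is a function of X_m, ..., X_n only, measurable in the sense that
   the event {th \in C_n} is in sigma(X_m, ..., X_n) for every [th]. *)
Definition built_from m C :=
  forall n th, (m <= n)%N ->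
    obs_sigma X [set k | (m <= k <= n)%N] [set w | C n w th].

Definition coverage m th C : set (stream X) :=
  [set w | forall n, (m <= n)%N -> C n w th].

Definition level_CS P th alpha m C :=
  built_from m C /\ (1 - alpha)%:E <= P (coverage m th C).

(* Level-(1 - alpha) coverage of the sequence started at time m, conditionally
   on F_(m-1), i.e. P (coverage | F_(m-1)) >= 1 - alpha almost surely, written
   with integrals over the events of F_(m-1). For m = 1 this is [level_CS];
   for independent data it is equivalent to [level_CS] for every m (see the
   two lemmas below). For dependent data the unconditional guarantee does not
   bound the average run length by 1/alpha: for U uniform on {1, 2} and
   X_n = 1{U = n}, let C^(m)_n be empty if X_m = 1 and everything otherwise;
   each C^(m) has level 1/2, but the detector stops at U and E[U] = 3/2 < 2. *)
Definition level_CS_given_past P th alpha m C :=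
  built_from m C /\
  forall A, natural_filtration X m.-1 A ->
    (1 - alpha)%:E * P A <= P (A `&` coverage m th C).

Lemma level_CS_given_pastW P th alpha m C :
  level_CS_given_past P th alpha m C -> level_CS P th alpha m C.
Proof.
move=> [mC /(_ setT)]; rewrite setTI probability_setT mule1 => cov.
by split=> //; apply: cov; rewrite -setC0; apply: sigma_algebraC;
  exact: sigma_algebra0.
Qed.

Lemma level_CS_independent P th alpha m C :
  (forall A B, natural_filtration X m.-1 A ->
    obs_sigma X [set k | (m <= k)%N] B -> P (A `&` B) = P A * P B) ->
  level_CS P th alpha m C -> level_CS_given_past P th alpha m C.
Proof.
move=> indep [mC cov]; split=> // A FA.
rewrite indep//; first by rewrite muleC lee_wpmul2l.
have -> : coverage m th C = ~` \bigcup_n ~` [set w | (m <= n)%N -> C n w th].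
  rewrite setC_bigcup; under eq_bigcapr do rewrite setCK.
  by apply/seteqP; split=> [w Cw n _ | w Cw n]; [exact: Cw | exact: (Cw n I)].
apply: sigma_algebraC; apply: sigma_algebra_bigcup => n.
apply: sigma_algebraC; have [mn|nm] := leqP m n; last first.
  rewrite (_ : [set w | _ -> C n w th] = ~` set0); last first.
    by rewrite setC0; apply/seteqP; split.
  by apply: sigma_algebraC; exact: sigma_algebra0.
rewrite (_ : [set w | _ -> C n w th] = [set w | C n w th]); last first.
  by apply/seteqP; split=> w Cw; [exact: Cw | move=> _].
apply: sub_sigma_algebra2 (mC n th mn) => _ [k [B [/andP[mk _] mB ->]]].
by exists k, B.
Qed.

End confidence_sequences.

Inductive problem (Theta : Type) :=
  | NonPartitioned
  | Partitioned of set Theta.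
Arguments NonPartitioned {Theta}.

Definition initial_set (Theta : Type) (pb : problem Theta) : set Theta :=
  if pb is Partitioned Theta0 then Theta0 else setT.

Section detector.
Context (R : realType) (Omega Theta : Type).
Implicit Types (C : nat -> nat -> Omega -> set Theta) (pb : problem Theta).

(* [C m n w] is C^(m)_n for [1 <= m <= n]; its other values are irrelevant. *)
Definition with_initial pb C (m n : nat) (w : Omega) : set Theta :=
  if m is 0 then initial_set pb else C m n w.

Definition nested C := forall m n' n w,
  (1 <= m)%N -> (m <= n')%N -> (n' < n)%N -> C m n w `<=` C m n' w.

Definition alarm pb C (n : nat) (w : Omega) : Prop :=
  \bigcap_(m in [set m | (m <= n)%N]) with_initial pb C m n w = set0.

Definition alarm_running pb C (n : nat) (w : Omega) : Prop :=
  \bigcap_(m in [set m | (m <= n)%N])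
    \bigcap_(i in [set i | (m <= i <= n)%N]) with_initial pb C m i w = set0.

(* [ereal_inf set0 = +oo] *)
Definition first_time (a : nat -> Omega -> Prop) (w : Omega) : \bar R :=
  ereal_inf [set n%:R%:E | n in [set n | (1 <= n)%N /\ a n w]].

End detector.
Arguments first_time R {Omega} a w.

(* Main.v *)
Require Import Defs.
From HB Require Import structures.
From mathcomp Require Import all_boot all_order all_algebra.
From mathcomp Require Import all_classical all_reals all_analysis.
From mathcomp Require Import measurable_realfun lra.

Set Implicit Arguments.
Unset Strict Implicit.
Unset Printing Implicit Defensive.

Import Order.TTheory GRing.Theory Num.Theory.
Local Open Scope classical_set_scope.
Local Open Scope ring_scope.

(** The proof charges the first failure to the confidence sequence that fails.

    Let [th] be the true parameter and let [sigma] be the first time at which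
    some confidence sequence started so far has excluded [th]. Since [th] lies
    in the initial set, an empty intersection means that some started sequence
    has lost [th]; hence [sigma <= tau] for both stopping criteria, and it
    suffices to bound [E sigma] from below.

    If [sigma] is finite, the sequence that fails at time [sigma] was started at
    some time [m <= sigma], and it fails to cover. The event [sigma >= m] is in
    F_(m-1), so the conditional coverage guarantee applies to it:
      P (sigma <= N) <= sum_(m <= N) P (sigma >= m, sequence m fails)
                     <= alpha * sum_(m <= N) P (sigma >= m)
                     <= alpha * E sigma.
    If [E sigma] is finite, then [sigma] is finite almost surely, and letting
    N tend to infinity gives [1 <= alpha * E sigma].

    In the code, [excluded_by th C m] is the event [sigma <= m], so that
    [sigma >= m.+1] is its complement, paired with the sequence started at time
    [m.+1] ([excluded_by_cover]). The probabilistic inequality is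
    [inv_le_integral_of_hazard], the limit argument [ge_invr_of_hazard]. The
    alarm events need not be measurable, as [Theta] is an arbitrary type, so
    [E sigma] enters only through the measurable finite sums
    [\sum_(m < N) \1_(~` excluded_by th C m)], which lie below [tau]. *)

(** * Lower bounds for integrals of arbitrary nonnegative functions *)

Section expectation_lower_bounds.
Context (R : realType) (d : measure_display) (T : measurableType d).
Local Open Scope ereal_scope.

(** The integral of a nonnegative function is a supremum over the simple
    functions below it, hence monotone even without measurability. This is
    what allows [g] to be a stopping time of non-measurable alarm events. *)
Lemma ge0_le_integral_minorant (mu : {measure set T -> \bar R})
    (f g : T -> \bar R) :
  (forall w, 0 <= f w) -> (forall w, f w <= g w) ->
  \int[mu]_w f w <= \int[mu]_w g w.
Proof.
move=> f0 fg; have g0 w : 0 <= g w by exact: le_trans (f0 w) (fg w).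
rewrite !ge0_integralTE//; apply: ereal_sup_le => _ [h hf <-].
by exists h => // w; exact: le_trans (hf w) (fg w).
Qed.

(** The half of [E f = sum_m P (f > m)] that is used: with [A m] the event
    [f > m], only finitely many terms and a pointwise bound are involved. *)
Lemma sum_survival_le_integral (mu : {measure set T -> \bar R})
    (A : (set T)^nat) (f : T -> \bar R) N :
  (forall m, measurable (A m)) ->
  (forall w, (\sum_(m < N) \1_(A m) w)%:E <= f w) ->
  \sum_(m < N) mu (A m) <= \int[mu]_w f w.
Proof.
move=> mA Af; pose g w : \bar R := \sum_(m < N) (\1_(A m) w)%:E.
have -> : \sum_(m < N) mu (A m) = \int[mu]_w g w.
  rewrite ge0_integral_sum//.
    by apply: eq_bigr => m _; rewrite integral_indic// setIT.
  by move=> m; apply/measurable_EFinP; exact: measurable_indic.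
apply: ge0_le_integral_minorant => w; last by rewrite /g sumEFin.
by apply: sume_ge0 => m _; rewrite lee_fin.
Qed.

End expectation_lower_bounds.

(** * A hazard rate of at most alpha forces a mean of at least 1/alpha *)

(** Here [q m] stands for [P (sigma > m)]. The hypotheses give
    [1 - alpha * E <= q N] for every [N]. Were the left-hand side positive, the
    partial sums of [q] would grow linearly and exceed [E]; this replaces the
    case distinction on whether [sigma] is almost surely finite. *)
Lemma ge_invr_of_hazard (R : realType) (alpha E : R) (q : R^nat) :
  0 < alpha ->
  (forall N, \sum_(m < N) q m <= E) ->
  (forall N, 1 - q N <= alpha * \sum_(m < N) q m) ->
  alpha^-1 <= E.
Proof.
move=> alpha0 qE hazard.
suff : 1 <= alpha * E by rewrite -[alpha^-1]mulr1 ler_pdivrMl.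
rewrite leNgt; apply/negP => aE1.
have E0 : 0 <= E by have := qE 0%N; rewrite big_ord0.
have qlow N : 1 - alpha * E <= q N.
  have : alpha * \sum_(m < N) q m <= alpha * E by rewrite ler_pM2l.
  by have := hazard N; lra.
have e0 : 0 < 1 - alpha * E by lra.
have NE N : N%:R * (1 - alpha * E) <= E.
  apply: le_trans (qE N); rewrite mulr_natl -[X in _ *+ X]card_ord -sumr_const.
  by apply: ler_sum => i _.
pose x := E / (1 - alpha * E).
have x0 : 0 <= x by rewrite divr_ge0// ltW.
have := archi_boundP x0; rewrite ltr_pdivrMr// ltNge => /negP; apply.
exact: NE.
Qed.

Section hazard.
Context (R : realType) (d : measure_display) (T : measurableType d).
Local Open Scope ereal_scope.

(** Conditional coverage at least [1 - alpha] on [A], read as a bound on the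
    failure probability. *)
Lemma measure_setIC_le (P : probability T R) (alpha : R) (A B : set T) :
  measurable A -> measurable B ->
  (1 - alpha)%:E * P A <= P (A `&` B) -> P (A `&` ~` B) <= alpha%:E * P A.
Proof.
move=> mA mB.
have -> : P (A `&` ~` B) = P A - P (A `&` B).
  by rewrite -setDE measureD// -ge0_fin_numE// fin_num_measure.
rewrite -(fineK (fin_num_measure P _ mA)).
rewrite -(fineK (fin_num_measure P _ (measurableI _ _ mA mB))).
by rewrite -!EFinM -EFinB !lee_fin; lra.
Qed.

(** [S n] is the event that a stop has occurred by time [n], and [V m] the
    failure that can cause a stop only after time [m]. A union bound over
    [m < N] turns the conditional bounds into
    [P (S N) <= alpha * sum_(m < N) P (~` S m)]. *)
Lemma inv_le_integral_of_hazard (P : probability T R) (alpha : R)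
    (S V : (set T)^nat) (f : T -> \bar R) :
  (0 < alpha)%R ->
  (forall n, measurable (S n)) -> (forall n, measurable (V n)) ->
  (forall m, P (~` S m `&` V m) <= alpha%:E * P (~` S m)) ->
  (forall n, S n `<=` \bigcup_(m in `I_n) (~` S m `&` V m)) ->
  (forall N w, (\sum_(m < N) \1_(~` S m) w)%:E <= f w) ->
  (alpha^-1)%:E <= \int[P]_w f w.
Proof.
move=> alpha0 mS mV hazard cover fS.
have mSC n : measurable (~` S n) by exact: measurableC.
have sumE N : \sum_(m < N) P (~` S m) <= \int[P]_w f w.
  exact: sum_survival_le_integral mSC (fS N).
pose q n := fine (P (~` S n)).
have Pq n : P (~` S n) = (q n)%:E by rewrite fineK// fin_num_measure.
have sumq N : \sum_(m < N) P (~` S m) = (\sum_(m < N) q m)%:E.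
  by rewrite -sumEFin; apply: eq_bigr.
have Ige0 : 0 <= \int[P]_w f w by have := sumE 0%N; rewrite big_ord0.
case: (\int[P]_w f w) Ige0 sumE => [E| |] // _ sumE; last exact: leey.
rewrite lee_fin; apply: (@ge_invr_of_hazard _ _ _ q) => //.
- by move=> N; rewrite -lee_fin -sumq.
- move=> N; rewrite -lee_fin EFinB -Pq -probability_setC// setCK.
  have mSV m : measurable (~` S m `&` V m) by exact: measurableI.
  have := cover N; rewrite bigcup_mkord => coverN.
  apply: le_trans (le_measure P _ _ coverN) _; rewrite ?inE//.
    by apply: bigsetU_measurable => i _; exact: mSV.
  apply: le_trans (Boole_inequality P (fun i _ => mSV i)) _.
  rewrite EFinM -sumq ge0_sume_distrr//.
  by apply: lee_sum => i _; exact: hazard.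
Qed.

End hazard.

(** * The first time at which the true parameter is excluded *)

Section exclusion.
Context (R : realType) (d : measure_display) (X : measurableType d).
Context (Theta : Type) (th : Theta) (C : nat -> nat -> stream X -> set Theta).

Definition excluded_by n : set (stream X) :=
  [set w | exists m i, (1 <= m <= i)%N /\ (i <= n)%N /\ ~ C m i w th].

Lemma excluded_by_le : {homo excluded_by : m n / (m <= n)%N >-> m `<=` n}.
Proof.
move=> n n' nn' w [m [i [mi [le_in nC]]]]; exists m, i; split=> //; split=> //.
exact: leq_trans nn'.
Qed.

Lemma natural_filtration_excluded_by n :
  (forall m, (1 <= m)%N -> built_from m (C m)) ->
  natural_filtration X n (excluded_by n).
Proof.
move=> built.
rewrite (_ : excluded_by n = \bigcup_m \bigcup_i
    [set w | [&& 1 <= m, m <= i & i <= n]%N /\ ~ C m i w th]); last first.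
  apply/seteqP; split=> [w [m [i [/andP[m1 mi] [le_in nC]]]]|w].
    by exists m => //; exists i => //; split=> //; rewrite m1 mi.
  move=> [m _ [i _ [/and3P[m1 mi le_in] nC]]]; exists m, i.
  by split; [rewrite m1 | split].
apply: sigma_algebra_bigcup => m; apply: sigma_algebra_bigcup => i.
have [/and3P[m1 mi le_in]|h] := boolP [&& 1 <= m, m <= i & i <= n]%N; last first.
  rewrite (_ : [set w | _ /\ ~ C m i w th] = set0); first exact: sigma_algebra0.
  by apply/seteqP; split=> // w [].
rewrite (_ : [set w | _ /\ ~ C m i w th] = ~` [set w | C m i w th]); last first.
  by apply/seteqP; split=> [w []|w nC].
apply: sigma_algebraC.
apply: sub_sigma_algebra2 (built m m1 i th mi) => _ [k [B [/andP[mk ki] mB ->]]].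
by exists k, B; split=> //=; rewrite (leq_trans m1 mk) (leq_trans ki le_in).
Qed.

Lemma measurable_obs_sigma (I : set nat) (A : set (stream X)) :
  I `<=` [set k | (1 <= k)%N] -> obs_sigma X I A -> measurable A.
Proof.
move=> I1; apply: sub_sigma_algebra2 => _ [k [B [Ik mB ->]]].
by exists k, B; split=> //; exact: I1.
Qed.

Lemma measurable_coverage m : (1 <= m)%N -> built_from m (C m) ->
  measurable (coverage m th (C m) : set (stream X)).
Proof.
move=> m1 built.
have -> : coverage m th (C m) =
    \bigcap_(n in [set n | (m <= n)%N]) [set w | C m n w th].
  by apply/seteqP; split=> w Cw n; exact: Cw.
apply: bigcap_measurableType => n mn.
apply: measurable_obs_sigma (built n th mn) => k /= /andP[mk _].
exact: leq_trans mk.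
Qed.

(** The sequence that fails at the first exclusion time was started at some
    [m.+1] not later than that time, hence while nothing was excluded by [m]. *)
Lemma excluded_by_cover n :
  excluded_by n `<=` \bigcup_(m in `I_n)
    (~` excluded_by m `&` ~` coverage m.+1 th (C m.+1)).
Proof.
elim: n => [|n IHn] w.
  by move=> [m [i [/andP[m1 mi] [i0 _]]]]; have := leq_trans m1 (leq_trans mi i0).
have [/IHn[j jn Ej] _|nE] := pselect (excluded_by n w).
  by exists j => //=; exact: ltnW.
move=> [m [i [/andP[m1 mi] [le_in nC]]]]; exists m.-1 => /=.
  by rewrite prednK//; exact: leq_trans le_in.
rewrite prednK//; split; last by move=> /(_ i mi).
move=> E; apply: nE; apply: excluded_by_le E.
by rewrite -ltnS prednK//; exact: leq_trans le_in.
Qed.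

(** The true parameter belongs to the initial set, so an empty running
    intersection must be due to some sequence that has lost it. *)
Lemma alarm_running_excluded pb n w :
  initial_set pb th -> alarm_running pb C n w -> excluded_by n w.
Proof.
move=> pbth alarmed; apply: contrapT => nE.
have : (set0 : set Theta) th; last by [].
rewrite -alarmed => m /= mn i /= /andP[mi le_in].
case: m mn mi => [|m] mn mi //=.
by apply: contrapT => nC; apply: nE; exists m.+1, i.
Qed.

(** At an alarm time [n] the parameter has been excluded by [n], so only the
    terms with [m < n] can be nonzero. If there is no alarm, the infimum of the
    empty set is infinite and there is nothing to prove. *)
Lemma sum_survival_le_first_time (a : nat -> stream X -> Prop) N w :
  (forall n, a n w -> excluded_by n w) ->
  ((\sum_(m < N) \1_(~` excluded_by m) w : R)%:E <= first_time R a w)%E.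
Proof.
move=> aE; apply: le_ereal_inf_tmp => _ [n [_ an] <-]; rewrite lee_fin.
apply: (@le_trans _ _ (minn N n)%:R); last by rewrite ler_nat geq_minr.
elim: N => [|N IHN]; first by rewrite big_ord0 ler0n.
rewrite big_ord_recr/=; have [nN|Nn] := leqP n N.
  have En : excluded_by N w by exact: excluded_by_le (aE _ an).
  rewrite indicE memNset ?addr0; last exact.
  by rewrite (minn_idPr (leqW nN)); rewrite (minn_idPr nN) in IHN.
rewrite (minn_idPl Nn) -natr1 lerD//.
by rewrite (minn_idPl (ltnW Nn)) in IHN.
Qed.

End exclusion.

(** * The average run length *)

Theorem theorem2p2 (R : realType) (d : measure_display) (X : measurableType d)
    (Theta : Type) (calP : set (probability (stream X) R))
    (theta : probability (stream X) R -> Theta)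
    (alpha : R) (halpha : 0 < alpha < 1)
    (pb : problem Theta)
    (P0 : probability (stream X) R) (hP0 : calP P0)
    (htheta0 : initial_set pb (theta P0))
    (C : nat -> nat -> stream X -> set Theta)
    (hC : forall m, (1 <= m)%N ->
      level_CS_given_past P0 (theta P0) alpha m (C m)) :
  (nested C ->
    ((alpha^-1)%:E <= \int[P0]_w first_time R (alarm pb C) w)%E) /\
  ((alpha^-1)%:E <= \int[P0]_w first_time R (alarm_running pb C) w)%E.
Proof.
have alpha0 : 0 < alpha by case/andP: halpha.
have built m : (1 <= m)%N -> built_from m (C m) by move=> /hC[].
set th := theta P0 in htheta0 hC *.
have mE n : measurable (excluded_by th C n).
  apply: (@measurable_obs_sigma _ X [set k | (1 <= k <= n)%N]).
    by move=> k /andP[].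
  exact: natural_filtration_excluded_by.
have mCov m : measurable (coverage m.+1 th (C m.+1)).
  by apply: measurable_coverage => //; exact: built.
have mSC m : measurable (~` excluded_by th C m) by exact: measurableC.
have hazard m : (P0 (~` excluded_by th C m `&` ~` coverage m.+1 th (C m.+1)) <=
    alpha%:E * P0 (~` excluded_by th C m))%E.
  have FmSC : natural_filtration X m (~` excluded_by th C m).
    by apply: sigma_algebraC; exact: natural_filtration_excluded_by built.
  apply: measure_setIC_le => //.
  by have [_ /(_ _ FmSC)] := hC m.+1 isT.
have bound (a : nat -> stream X -> Prop) :
    (forall n w, a n w -> excluded_by th C n w) ->
    ((alpha^-1)%:E <= \int[P0]_w first_time R a w)%E.
  move=> aE.
  apply: (inv_le_integral_of_hazard alpha0 mE _ hazard).
  - by move=> n; exact: measurableC.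
  - exact: excluded_by_cover.
  - by move=> N w; apply: sum_survival_le_first_time => n; exact: aE.
(* An alarm is a running alarm, whose intersection has more terms. *)
split=> [_|]; apply: bound => n w; last exact: alarm_running_excluded.
move=> alarmed; apply: (alarm_running_excluded htheta0); rewrite /alarm_running.
apply/seteqP; split=> // t Ct; rewrite -alarmed => m mn.
by apply: (Ct m mn n) => /=; rewrite mn leqnn.
Qed.
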